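(* Let $G=(V,E,c)$ be a finite connected weighted graph with positive edge conductances and effective-resistance matrix $R$, and for nonempty $T\subseteq V$ put $\rho_G(T)=\det R[T]/\operatorname{cof}R[T]$. Let $S\subseteq V$ with $|S|\ge2$, and let $x\in V\setminus S$. Put $A=R[S]$ and $b=R[S,x]\in\mathbb{R}^S$, where $b_s=R_{sx}$. Define $$a=b^{\mathsf T}A^{-1}\mathbf 1,\qquad \eta=b^{\mathsf T}A^{-1}b.$$ Then $\eta>0$ and $$\frac1{\rho_G(S\cup\{x\})}=\frac1{\rho_G(S)}-\frac{(a-1)^2}{\eta}.$$ Equivalently, $$\rho_G(S\cup\{x\})=\frac{\rho_G(S)\,\eta}{\eta-\rho_G(S)(a-1)^2}.$$ Moreover, if $u_{S\cup\{x\}}$ denotes the unique maximizer of $u^{\mathsf T}R[S\cup\{x\}]u$ over all $u\in\mathbb{R}^{S\cup\{x\}}$ with $\mathbf 1^{\mathsf T}u=1$, then $$u_{S\cup\{x\}}(x)=\rho_G(S\cup\{x\})\,\frac{a-1}{\eta}.$$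
   Context: $G=(V,E,c)$ is a finite connected undirected graph with edge conductances $c_e>0$; parallel edges are allowed, loops are omitted. With $N\in\mathbb{R}^{V\times E}$ the incidence matrix for an arbitrary orientation and $C=\operatorname{diag}(c_e)$, the weighted Laplacian is $L=NCN^{\mathsf T}$, and $L^+$ is its Moore--Penrose pseudoinverse. The effective resistance between $i,j\in V$ is $R_{ij}=(e_i-e_j)^{\mathsf T}L^+(e_i-e_j)$, and $R=(R_{ij})_{i,j\in V}$. For $T\subseteq V$, $R[T]$ is the principal submatrix of $R$ indexed by $T$. $\mathbf 1$ is the all-ones vector of the appropriate dimension. For a square matrix $M$, $\operatorname{cof}M=\sum_{i,j}(-1)^{i+j}\det M(i|j)$ is the sum of all cofactors, where $M(i|j)$ is $M$ with row $i$ and column $j$ deleted; for a $1\times1$ matrix it equals $1$. It is a fact that for $|T|\ge2$ the matrix $R[T]$ is invertible, $\operatorname{cof}R[T]\neq0$, $\rho_G(T)>0$, and the maximum of $u^{\mathsf T}R[T]u$ over $u\in\mathbb{R}^T$ with $\mathbf 1^{\mathsf T}u=1$ equals $\rho_G(T)$ and is attained at the unique vector $u_T=\rho_G(T)R[T]^{-1}\mathbf 1$. *)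

(* Defs.v *)
From HB Require Import structures.
From mathcomp Require Import all_boot all_order all_algebra.
Set Implicit Arguments. Unset Strict Implicit. Unset Printing Implicit Defensive.
Import Order.TTheory GRing.Theory Num.Theory.
Local Open Scope ring_scope.

Section MoorePenrose.
Context {K : realFieldType}.

(* The four Penrose equations; [mxalgebra.pinvmx] only satisfies the first. *)
Definition moore_penrose m n (A : 'M[K]_(m, n)) (B : 'M[K]_(n, m)) : bool :=
  [&& A *m B *m A == A, B *m A *m B == B,
      (A *m B)^T == A *m B & (B *m A)^T == B *m A].

Lemma gram_unitmx m n (F : 'M[K]_(m, n)) : row_free F -> F *m F^T \in unitmx.
Proof.
move=> Ffree; rewrite -row_free_unit -kermx_eq0; apply/eqP/row_matrixP => i.
rewrite row0; set u := row i _.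
have uFF : u *m (F *m F^T) = 0 by rewrite -row_mul mulmx_ker row0.
have norm0 : \sum_j ((u *m F) ord0 j) ^+ 2 = 0.
  have := congr1 (fun M : 'M_(1, m) => (M *m u^T) ord0 ord0) uFF.
  rewrite mul0mx [in RHS]mxE => {2}<-.
  rewrite mulmxA -(mulmxA (u *m F)) -trmx_mul [in RHS]mxE.
  by apply: eq_bigr => j _; rewrite [((_ *m _)^T) j _]mxE expr2.
have uF0 : u *m F = 0.
  apply/rowP => j; rewrite [RHS]mxE; apply/eqP.
  rewrite -sqrf_eq0; apply/eqP.
  by apply: (psumr_eq0P _ norm0) => // k _; rewrite sqr_ge0.
by apply: (row_free_inj Ffree); rewrite uF0 mul0mx.
Qed.

Lemma moore_penrose_ex m n (A : 'M[K]_(m, n)) : exists B, moore_penrose A B.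
Proof.
have [C [F [defA Cfree Ffree]]] : exists C : 'M[K]_(m, \rank A),
    exists F : 'M[K]_(\rank A, n), [/\ A = C *m F, row_free C^T & row_free F].
  exists (col_base A), (row_base A); split; rewrite ?mulmx_base //.
    by rewrite /row_free mxrank_tr; apply: col_base_full.
  exact: row_base_free.
have uF := gram_unitmx Ffree; have := gram_unitmx Cfree; rewrite trmxK => uC.
move: (\rank A) => r in C F defA Cfree Ffree uF uC *; subst A.
set P := F *m F^T in uF; set Q := C^T *m C in uC.
have trP : P^T = P by rewrite trmx_mul trmxK.
have trQ : Q^T = Q by rewrite trmx_mul trmxK.
pose B := F^T *m invmx P *m invmx Q *m C^T.
have eAB : C *m F *m B = C *m invmx Q *m C^T.
  by rewrite /B !mulmxA -(mulmxA C F) -/P -(mulmxA C P) mulmxV // mulmx1.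
have eBA : B *m (C *m F) = F^T *m invmx P *m F.
  rewrite /B !mulmxA -(mulmxA _ C^T C) -/Q.
  by rewrite -(mulmxA _ (invmx Q) Q) mulVmx // mulmx1.
exists B; apply/and4P; split; apply/eqP.
- rewrite eAB !mulmxA -(mulmxA _ C^T C) -/Q.
  by rewrite -(mulmxA C (invmx Q)) mulVmx // mulmx1.
- rewrite eBA {2}/B !mulmxA -(mulmxA _ F F^T) -/P.
  by rewrite -(mulmxA F^T (invmx P) P) mulVmx // mulmx1.
- by rewrite eAB !trmx_mul trmxK trmx_inv trQ mulmxA.
- by rewrite eBA !trmx_mul trmxK trmx_inv trP mulmxA.
Qed.

Lemma moore_penrose_uniq m n (A : 'M[K]_(m, n)) (B B' : 'M[K]_(n, m)) :
  moore_penrose A B -> moore_penrose A B' -> B = B'.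
Proof.
move=> /and4P[/eqP a1 /eqP a2 /eqP a3 /eqP a4].
move=> /and4P[/eqP b1 /eqP b2 /eqP b3 /eqP b4].
have eAB : A *m B = A *m B'.
  by rewrite -a3 -[in LHS]b1 -mulmxA trmx_mul a3 b3 mulmxA a1.
have eBA : B *m A = B' *m A.
  rewrite -a4 -[in LHS]b1 -(mulmxA A) mulmxA trmx_mul b4 a4.
  by rewrite -mulmxA (mulmxA A B A) a1.
by rewrite -a2 eBA -mulmxA eAB mulmxA b2.
Qed.

Definition mpinv m n (A : 'M[K]_(m, n)) : 'M[K]_(n, m) :=
  xchoose (moore_penrose_ex A).

Lemma mpinvP m n (A : 'M[K]_(m, n)) : moore_penrose A (mpinv A).
Proof. exact: xchooseP. Qed.

End MoorePenrose.

(* Undirected, loopless; distinct edges may have the same set of ends. *)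
Record wgraph (K : realFieldType) (V E : finType) := WGraph {
  ends : E -> {set V};
  cond : E -> K;
  card_ends : forall e, #|ends e| = 2%N;
  cond_gt0 : forall e, 0 < cond e
}.

Record orientation (K : realFieldType) (V E : finType) (G : wgraph K V E) :=
  Orientation {
    tail : E -> V;
    head : E -> V;
    ends_orientation : forall e, ends G e = [set tail e; head e]
  }.

(* Matrices and vectors indexed by a finite set T are indexed by 'I_#|T|
   through [enum_val] and [enum_rank] (or [enum_rank_in]). *)
Section Graph.
Context {K : realFieldType} {V E : finType}.
Implicit Type G : wgraph K V E.

Definition adj G : rel V := [rel u v | [exists e, ends G e == [set u; v]]].

Definition connected G : Prop := forall u v : V, connect (adj G) u v.

Definition incidence G (o : orientation G) : 'M[K]_(#|V|, #|E|) :=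
  \matrix_(v, e) ((enum_val v == head o (enum_val e))%:R
                  - (enum_val v == tail o (enum_val e))%:R).

Definition condmx G : 'M[K]_#|E| := diag_mx (\row_e cond G (enum_val e)).

Definition laplacian G (o : orientation G) : 'M[K]_#|V| :=
  incidence o *m condmx G *m (incidence o)^T.

Definition stdvec (i : V) : 'cV[K]_#|V| := delta_mx (enum_rank i) ord0.

Definition eff_res G (o : orientation G) (i j : V) : K :=
  let d := stdvec i - stdvec j in
  (d^T *m mpinv (laplacian o) *m d) ord0 ord0.

Definition resmx G (o : orientation G) (T : {set V}) : 'M[K]_#|T| :=
  \matrix_(i, j) eff_res o (enum_val i) (enum_val j).

End Graph.

Section QuadraticOptimisation.
Context {K : realFieldType}.

Definition sum_cofactors n (M : 'M[K]_n) : K := \sum_i \sum_j cofactor M i j.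

Definition quad n (M : 'M[K]_n) (u : 'cV[K]_n) : K :=
  (u^T *m M *m u) ord0 ord0.

Definition ones n : 'cV[K]_n := const_mx 1.

Definition sum1 n (u : 'cV[K]_n) : Prop := ((ones n)^T *m u) ord0 ord0 = 1.

Definition is_maximizer n (M : 'M[K]_n) (u : 'cV[K]_n) : Prop :=
  sum1 u /\ forall v : 'cV[K]_n, sum1 v -> quad M v <= quad M u.

End QuadraticOptimisation.

Definition rho (K : realFieldType) (V E : finType) (G : wgraph K V E)
    (o : orientation G) (T : {set V}) : K :=
  \det (resmx o T) / sum_cofactors (resmx o T).

(* Main.v *)
Require Import Defs.
From HB Require Import structures.
From mathcomp Require Import all_boot all_order all_algebra.
From mathcomp Require Import ring lra.
Set Implicit Arguments. Unset Strict Implicit. Unset Printing Implicit Defensive.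
Import Order.TTheory GRing.Theory Num.Theory.
Local Open Scope ring_scope.

(** On vectors of sum zero the resistance form [u^T R u] equals
    [-2 u^T L^+ u], because [R i j = L^+ i i + L^+ j j - L^+ i j - L^+ j i] and
    the diagonal terms cancel. For a connected graph the kernel of [L] consists
    of the constant vectors, so this value is negative unless [u = 0]
    ([resmx_neg_type]). Every [R[T]] is therefore of strict negative type:
    symmetric, with zero diagonal, and negative definite on the zero-sum
    hyperplane. When [T] has at least two elements, the form is positive at the
    all-ones vector, so it has exactly one positive direction. From this alone
    follow the invertibility of [R[T]], the positivity of
    [1^T R[T]^-1 1 = 1 / rho T], and the fact that the normalisation of
    [R[T]^-1 1] to sum one is the unique maximizer ([neg_type_unitmx],
    [neg_type_inv_ones_gt0], [neg_type_maximizer]).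

    It remains to compare the solutions of [R[T] y = 1] for [T = S] and for
    [T = S + x], that is, to invert the block matrix [[A, b], [b^T, 0]] against
    the all-ones vector ([resmx_border]). Put [y = A^-1 1] and [z = A^-1 b].
    Eliminating the first block gives the solution [(y - q z, q)] with
    [q = (a - 1) / eta]. Its sum is [1 / rho S - (a - 1)^2 / eta], which is the
    recursion for [1 / rho], and its last coordinate, divided by its sum, is the
    value of the maximizer at [x].

    Finally [eta > 0], because [- eta] is the value of the enlarged form at
    [(z, -1)], and this vector is orthogonal, for that form, to [(1, 0)], at
    which the form is positive: a nonnegative value would make the form
    nonnegative on a plane, and a plane meets the zero-sum hyperplane in a
    nonzero vector. *)

(** * Inner products of column vectors *)

Section Dot.
Context {K : realFieldType}.

Definition dot n (u v : 'cV[K]_n) : K := (u^T *m v) ord0 ord0.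

Lemma dotE n (u v : 'cV[K]_n) : dot u v = \sum_i u i ord0 * v i ord0.
Proof. by rewrite /dot mxE; apply: eq_bigr => i _; rewrite mxE. Qed.

Lemma dotC n (u v : 'cV[K]_n) : dot u v = dot v u.
Proof. by rewrite !dotE; apply: eq_bigr => i _; rewrite mulrC. Qed.

Lemma dotDr n (u v w : 'cV[K]_n) : dot u (v + w) = dot u v + dot u w.
Proof. by rewrite /dot mulmxDr mxE. Qed.

Lemma dotDl n (u v w : 'cV[K]_n) : dot (v + w) u = dot v u + dot w u.
Proof. by rewrite dotC dotDr !(dotC u). Qed.

Lemma dotZr n (k : K) (u v : 'cV[K]_n) : dot u (k *: v) = k * dot u v.
Proof. by rewrite /dot -scalemxAr mxE. Qed.

Lemma dotZl n (k : K) (u v : 'cV[K]_n) : dot (k *: v) u = k * dot v u.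
Proof. by rewrite dotC dotZr (dotC u). Qed.

Lemma dotNr n (u v : 'cV[K]_n) : dot u (- v) = - dot u v.
Proof. by rewrite /dot mulmxN mxE. Qed.

Lemma dotNl n (u v : 'cV[K]_n) : dot (- v) u = - dot v u.
Proof. by rewrite dotC dotNr (dotC u). Qed.

Lemma dot0r n (u : 'cV[K]_n) : dot u 0 = 0.
Proof. by rewrite /dot mulmx0 mxE. Qed.

Lemma dot0l n (u : 'cV[K]_n) : dot 0 u = 0.
Proof. by rewrite dotC dot0r. Qed.

Lemma dot_sumr n (I : finType) (u : 'cV[K]_n) (F : I -> 'cV[K]_n) :
  dot u (\sum_i F i) = \sum_i dot u (F i).
Proof. by rewrite /dot mulmx_sumr summxE. Qed.

Lemma dot_suml n (I : finType) (u : 'cV[K]_n) (F : I -> 'cV[K]_n) :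
  dot (\sum_i F i) u = \sum_i dot (F i) u.
Proof. by rewrite dotC dot_sumr; apply: eq_bigr => i _; rewrite dotC. Qed.

Lemma dot_mulmx m n (M : 'M[K]_(m, n)) (u : 'cV[K]_m) (v : 'cV[K]_n) :
  dot u (M *m v) = dot (M^T *m u) v.
Proof. by rewrite /dot trmx_mul trmxK mulmxA. Qed.

Lemma dot_ones n (u : 'cV[K]_n) : dot (ones n) u = \sum_i u i ord0.
Proof. by rewrite dotE; apply: eq_bigr => i _; rewrite mxE mul1r. Qed.

Lemma quad_dot n (M : 'M[K]_n) (u : 'cV[K]_n) : quad M u = dot u (M *m u).
Proof. by rewrite /quad /dot mulmxA. Qed.

Lemma quadZ n (M : 'M[K]_n) (k : K) (u : 'cV[K]_n) :
  quad M (k *: u) = k ^+ 2 * quad M u.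
Proof. by rewrite !quad_dot -scalemxAr dotZr dotZl mulrA expr2. Qed.

Lemma quadD n (M : 'M[K]_n) (u v : 'cV[K]_n) : M^T = M ->
  quad M (u + v) = quad M u + 2 * dot v (M *m u) + quad M v.
Proof.
move=> symM; rewrite !quad_dot mulmxDr !dotDr !dotDl.
by rewrite (dot_mulmx M u v) symM (dotC (M *m u)); ring.
Qed.

Lemma dot_delta n (u : 'cV[K]_n) i : dot u (delta_mx i ord0) = u i ord0.
Proof.
rewrite dotE (bigD1 i) //= big1 => [|j ji]; rewrite mxE.
  by rewrite !eqxx mulr1 addr0.
by rewrite (negbTE ji) mulr0.
Qed.

Lemma quad_sum n (M : 'M[K]_n) (u : 'cV[K]_n) :
  quad M u = \sum_i \sum_j u i ord0 * u j ord0 * M i j.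
Proof.
rewrite quad_dot dotE; apply: eq_bigr => i _.
by rewrite mxE mulr_sumr; apply: eq_bigr => j _; ring.
Qed.

End Dot.

(** * Matrices of strict negative type *)

Section NegativeType.
Context {K : realFieldType}.

Definition strict_negative_type n (M : 'M[K]_n) : Prop :=
  [/\ M^T = M, forall i, M i i = 0 &
      forall u : 'cV[K]_n, dot (ones n) u = 0 -> u != 0 -> quad M u < 0].

Lemma sum_cofactors_dot n (M : 'M[K]_n) :
  sum_cofactors M = dot (ones n) (\adj M *m ones n).
Proof.
rewrite dot_ones /sum_cofactors exchange_big; apply: eq_bigr => i _.
by rewrite mxE; apply: eq_bigr => j _; rewrite !mxE mulr1.
Qed.

(** Both sides involve the adjugate [\det M *: invmx M]; its entries are the
    cofactors of [M]. *)
Lemma det_div_sum_cofactors n (M : 'M[K]_n) : M \in unitmx ->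
  \det M / sum_cofactors M = (dot (ones n) (invmx M *m ones n))^-1.
Proof.
move=> uM; rewrite sum_cofactors_dot [invmx M]/invmx uM -scalemxAl dotZr.
by rewrite invfM invrK.
Qed.

Variables (n : nat) (M : 'M[K]_n).
Hypothesis Mneg : strict_negative_type M.
Hypothesis n_gt1 : (1 < n)%N.

Lemma neg_type_sym : M^T = M. Proof. by case: Mneg. Qed.

Lemma neg_type_quad_le0 (u : 'cV[K]_n) : dot (ones n) u = 0 -> quad M u <= 0.
Proof.
case: Mneg => _ _ ltM u0; have [->|/(ltM u u0)/ltW//] := eqVneq u 0.
by rewrite quad_dot mulmx0 dot0r.
Qed.

(** The form takes the value [-2 M i j] at [e_i - e_j]. *)
Lemma neg_type_offdiag_gt0 i j : i != j -> 0 < M i j.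
Proof.
case: Mneg => symM diagM ltM ij.
pose d : 'cV[K]_n := delta_mx i ord0 - delta_mx j ord0.
have sumd : dot (ones n) d = 0.
  by rewrite /d dotDr dotNr !dot_delta !mxE subrr.
have d0 : d != 0.
  apply/eqP => /(congr1 (fun u : 'cV[K]_n => u i ord0))/eqP.
  by rewrite !mxE !eqxx (negbTE ij) subr0 oner_eq0.
have := ltM d sumd d0; rewrite quad_dot /d mulmxBr !dotDr !dotDl !dotNr !dotNl.
rewrite !(dotC (delta_mx _ _)) !dot_delta -!colE !mxE !diagM.
have -> : M j i = M i j by rewrite -[in RHS]symM mxE.
by lra.
Qed.

Lemma neg_type_quad_ones_gt0 : 0 < quad M (ones n).
Proof.
case: Mneg => _ diagM _; rewrite quad_sum.
have M_ge0 i j : 0 <= ones n i ord0 * ones n j ord0 * M i j :> K.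
  rewrite !mxE !mul1r; have [->|ij] := eqVneq i j; first by rewrite diagM.
  exact/ltW/neg_type_offdiag_gt0.
pose i0 := Ordinal (ltnW n_gt1); pose i1 := Ordinal n_gt1.
rewrite (bigD1 i0) //= (bigD1 i1) //= -addrA ltr_pwDl //.
  by rewrite !mxE !mul1r; apply: neg_type_offdiag_gt0.
by rewrite addr_ge0 ?sumr_ge0 // => i _; rewrite sumr_ge0.
Qed.

Lemma dot_ones_ones_gt0 : 0 < dot (ones n) (ones n) :> K.
Proof.
rewrite dot_ones (eq_bigr (fun=> 1)) => [|i _]; last by rewrite mxE.
by rewrite sumr_const card_ord ltr0n ltnW.
Qed.

(** The all-ones vector spans a positive line, and correcting it by a multiple
    of [u] lands in the hyperplane of zero-sum vectors, where the form is
    nonpositive; comparing the two values bounds the form at [u]. *)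
Lemma neg_type_quad_ones_sub (k : K) (u : 'cV[K]_n) :
  k * dot (ones n) u = dot (ones n) (ones n) ->
  quad M (ones n) - 2 * k * dot (ones n) (M *m u) + k ^+ 2 * quad M u <= 0.
Proof.
move=> ku; have sw : dot (ones n) (ones n - k *: u) = 0.
  by rewrite dotDr dotNr dotZr ku subrr.
have := neg_type_quad_le0 sw.
suff -> : quad M (ones n - k *: u) =
    quad M (ones n) - 2 * k * dot (ones n) (M *m u) + k ^+ 2 * quad M u.
  by [].
rewrite -scaleNr addrC quadD ?neg_type_sym // quadZ -scalemxAr dotZr.
by ring.
Qed.

(** A kernel vector of nonzero sum would let the form attain, on the zero-sum
    hyperplane, its positive value at [ones n]. *)
Lemma neg_type_unitmx : M \in unitmx.
Proof.
case: Mneg => symM _ ltM; rewrite -row_free_unit -kermx_eq0.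
apply/eqP/row_matrixP => i; rewrite row0; set r := row i _.
have rM : M *m r^T = 0.
  by rewrite -[in LHS]symM -trmx_mul -row_mul mulmx_ker row0 trmx0.
apply: trmx_inj; rewrite trmx0; apply/eqP/negPn/negP => r0.
have [sr|/divfK sr] := eqVneq (dot (ones n) r^T) 0.
  by have := ltM _ sr r0; rewrite quad_dot rM dot0r ltxx.
have := neg_type_quad_ones_sub (sr _).
rewrite (quad_dot M r^T) rM !dot0r; have := neg_type_quad_ones_gt0; lra.
Qed.

Lemma mulmx_inv_ones : M *m (invmx M *m ones n) = ones n.
Proof. by rewrite mulKVmx ?neg_type_unitmx. Qed.

Lemma neg_type_inv_ones_gt0 : 0 < dot (ones n) (invmx M *m ones n).
Proof.
case: Mneg => _ _ ltM; set y := invmx M *m _.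
have My : M *m y = ones n := mulmx_inv_ones.
have qy : quad M y = dot (ones n) y by rewrite quad_dot My dotC.
have o_gt0 := dot_ones_ones_gt0; have q_gt0 := neg_type_quad_ones_gt0.
have [sy|sy] := eqVneq (dot (ones n) y) 0.
  have [y0|/(ltM y sy)] := eqVneq y 0; last by rewrite qy sy ltxx.
  by move: o_gt0; rewrite -{2}My y0 mulmx0 dot0r ltxx.
have := neg_type_quad_ones_sub (divfK sy _).
rewrite qy My; set m := dot (ones n) (ones n) in o_gt0 *; set s := dot _ y in sy *.
have -> : quad M (ones n) - 2 * (m / s) * m + (m / s) ^+ 2 * s
        = quad M (ones n) - m ^+ 2 / s by field.
rewrite subr_le0 => /(lt_le_trans q_gt0).
by rewrite pmulr_rgt0 ?exprn_gt0 // invr_gt0.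
Qed.

(** At [u] the gradient [M *m u] is a multiple of [ones n], so moving from [u]
    to another vector of sum one changes the form only by its value at the
    zero-sum displacement, which is negative. *)
Lemma neg_type_maximizer :
  let y := invmx M *m ones n in
  unique (is_maximizer M) ((dot (ones n) y)^-1 *: y).
Proof.
case: Mneg => symM _ ltM y; set u := _ *: y.
have My : M *m y = ones n := mulmx_inv_ones.
have sy := lt0r_neq0 neg_type_inv_ones_gt0; rewrite -/y in sy.
have su : dot (ones n) u = 1 by rewrite dotZr mulVf.
have Mu : M *m u = (dot (ones n) y)^-1 *: ones n by rewrite -scalemxAr My.
have quadv v : sum1 v -> dot (ones n) (v - u) = 0 /\
    quad M v = quad M u + quad M (v - u).
  move=> sv; have sw : dot (ones n) (v - u) = 0.
    by rewrite dotDr dotNr su [dot _ v]sv subrr.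
  split=> //; rewrite -{1}[v](subrKC u) (quadD u) // Mu.
  by rewrite dotZr (dotC (v - u)) sw !mulr0 addr0.
split; [split=> // v /quadv[sw ->] | move=> v [sv maxv]].
  by rewrite gerDl neg_type_quad_le0.
have [sw qv] := quadv v sv; have := maxv u su; rewrite qv lerDl => qw.
apply/esym/eqP; rewrite -subr_eq0; apply/negPn/negP => /(ltM _ sw).
by rewrite ltNge qw.
Qed.

End NegativeType.

(** * The resistance form of a connected graph *)

Section Resistance.
Context {K : realFieldType} {V E : finType}.
Variables (G : wgraph K V E) (o : orientation G).

Lemma laplacian_sym : (laplacian o)^T = laplacian o.
Proof. by rewrite /laplacian !trmx_mul trmxK tr_diag_mx mulmxA. Qed.

Lemma incidence_trE (p : 'cV[K]_#|V|) e :
  ((incidence o)^T *m p) e ord0 =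
  p (enum_rank (Defs.head o (enum_val e))) ord0
  - p (enum_rank (tail o (enum_val e))) ord0.
Proof.
have pick w : \sum_j (enum_val j == w)%:R * p j ord0 = p (enum_rank w) ord0.
  rewrite (bigD1 (enum_rank w)) //= enum_rankK eqxx mul1r big1 ?addr0 // => j jw.
  by rewrite (can2_eq enum_valK enum_rankK) (negbTE jw) mul0r.
rewrite mxE -!pick -sumrB; apply: eq_bigr => j _.
by rewrite !mxE mulrBl.
Qed.

Lemma quad_laplacian (p : 'cV[K]_#|V|) :
  quad (laplacian o) p = \sum_e cond G e *
    (p (enum_rank (Defs.head o e)) ord0 - p (enum_rank (tail o e)) ord0) ^+ 2.
Proof.
rewrite quad_dot /laplacian -!mulmxA dot_mulmx dotE.
rewrite [RHS]big_enum_val; apply: eq_bigr => /= e _.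
have := incidence_trE p e; rewrite mul_diag_mx !mxE => ->.
by ring.
Qed.

Lemma quad_laplacian_ge0 p : 0 <= quad (laplacian o) p.
Proof.
rewrite quad_laplacian sumr_ge0 // => e _.
by rewrite mulr_ge0 ?sqr_ge0 // ltW ?cond_gt0.
Qed.

Lemma laplacian_ones : laplacian o *m ones #|V| = 0.
Proof.
rewrite /laplacian -mulmxA.
suff -> : (incidence o)^T *m ones #|V| = 0 by rewrite mulmx0.
by apply/colP => e; rewrite incidence_trE !mxE subrr.
Qed.

Hypothesis Gconn : connected G.

(** A potential of zero energy is constant along every edge, hence along every
    path. *)
Lemma quad_laplacian_eq0 p : quad (laplacian o) p = 0 ->
  exists k, p = k *: ones #|V|.
Proof.
rewrite quad_laplacian => /psumr_eq0P p0.
have pe e : p (enum_rank (Defs.head o e)) ord0 = p (enum_rank (tail o e)) ord0.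
  have /eqP : cond G e * (p (enum_rank (Defs.head o e)) ord0
     - p (enum_rank (tail o e)) ord0) ^+ 2 = 0.
    apply: p0 => // e' _.
    by rewrite mulr_ge0 ?sqr_ge0 // ltW ?cond_gt0.
  by rewrite mulf_eq0 (gt_eqF (cond_gt0 G e)) sqrf_eq0 subr_eq0 => /eqP.
have padj u v : adj G u v -> p (enum_rank u) ord0 = p (enum_rank v) ord0.
  case/existsP => e /eqP; rewrite (ends_orientation o) => ends_uv.
  have p_end w : w \in [set u; v] ->
      p (enum_rank w) ord0 = p (enum_rank (tail o e)) ord0.
    by rewrite -ends_uv => /set2P[]->; rewrite ?pe.
  by rewrite (p_end u) ?(p_end v) ?set21 ?set22.
have pconn u v : p (enum_rank u) ord0 = p (enum_rank v) ord0.
  have /connectP[s us ->] := Gconn u v.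
  by elim: s u us => //= w s IHs u /andP[/padj-> /IHs].
have [i0 _|noV] := pickP (fun _ : 'I_#|V| => true); last first.
  by exists 0; apply/colP => j; have := noV j.
exists (p i0 ord0); apply/colP => i; rewrite !mxE mulr1.
by rewrite -[i]enum_valK -[i0]enum_valK; apply: pconn.
Qed.

(** The column space of the Laplacian is the hyperplane of zero-sum vectors:
    the Penrose equations put [d - L L^+ d] in the kernel of [L], which
    consists of the constant vectors, and this vector still has sum zero. *)
Lemma laplacian_mpinvK (d : 'cV[K]_#|V|) : dot (ones #|V|) d = 0 ->
  laplacian o *m (mpinv (laplacian o) *m d) = d.
Proof.
move=> sd; have := mpinvP (laplacian o); have := laplacian_sym.
have := laplacian_ones; have := @quad_laplacian_eq0.
set L := laplacian o; set P := mpinv L => kerL L1 symL.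
case/and4P => /eqP LPL _ /eqP symLP _.
set r := d - L *m (P *m d).
have sr : dot (ones #|V|) r = 0.
  by rewrite dotDr dotNr sd dot_mulmx symL L1 dot0l subrr.
have Lr : L *m r = 0.
  rewrite mulmxBr (mulmxA L P) -symLP (trmx_mul L P) symL.
  rewrite (mulmxA L (_ *m L)) (mulmxA L (P^T)).
  have : (L *m P *m L)^T = L^T by rewrite LPL.
  by rewrite (trmx_mul (L *m P)) (trmx_mul L P) symL mulmxA => ->; rewrite subrr.
have [|k rk] := kerL r; first by rewrite quad_dot Lr dot0r.
suff r0 : r = 0 by apply/esym/eqP; rewrite -subr_eq0 -/r r0.
apply/colP => i; move: sr; rewrite rk dotZr => /eqP.
rewrite mulf_eq0 => /orP[/eqP-> | so]; first by rewrite !mxE mul0r.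
move: so; rewrite dot_ones psumr_eq0 => [|j _]; last by rewrite mxE ler01.
by move=> /allP/(_ i (mem_index_enum i)); rewrite mxE oner_eq0.
Qed.

(** Since [d = L p] for the potential [p = L^+ d], the value is the energy
    [p^T L p]. *)
Lemma quad_mpinv_gt0 (d : 'cV[K]_#|V|) : dot (ones #|V|) d = 0 -> d != 0 ->
  0 < quad (mpinv (laplacian o)) d.
Proof.
move=> sd d0; have LPd := laplacian_mpinvK sd.
set p := mpinv _ *m d in LPd.
have -> : quad (mpinv (laplacian o)) d = quad (laplacian o) p.
  by rewrite !quad_dot LPd dotC.
rewrite lt_def quad_laplacian_ge0 andbT; apply: contraNneq d0.
case/quad_laplacian_eq0 => k pk.
by rewrite -LPd pk -scalemxAr laplacian_ones scaler0.
Qed.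

(** Extension by zero of a vector indexed by [T]. *)
Definition embed (T : {set V}) (u : 'cV[K]_#|T|) : 'cV[K]_#|V| :=
  \sum_i u i ord0 *: stdvec (enum_val i).

Lemma embed_out (T : {set V}) (u : 'cV[K]_#|T|) v :
  v \notin T -> embed u (enum_rank v) ord0 = 0.
Proof.
move=> vT; rewrite summxE big1 // => i _; rewrite !mxE.
rewrite (inj_eq enum_rank_inj) eqxx andbT.
have [vi|] := eqVneq v (enum_val i); last by rewrite mulr0.
by rewrite vi enum_valP in vT.
Qed.

Lemma embed_in (T : {set V}) (u : 'cV[K]_#|T|) i :
  embed u (enum_rank (enum_val i)) ord0 = u i ord0.
Proof.
rewrite summxE (bigD1 i) //= big1 => [|j ji]; rewrite !mxE.
  by rewrite !eqxx mulr1 addr0.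
by rewrite (inj_eq enum_rank_inj) (inj_eq enum_val_inj) eq_sym (negbTE ji) mulr0.
Qed.

Lemma eff_res_sym i j : eff_res o i j = eff_res o j i.
Proof.
rewrite /eff_res /= -[stdvec i - _]opprB; set d := stdvec j - _.
by rewrite [(- d)^T]linearN !mulNmx mulmxN opprK.
Qed.

Lemma eff_res_diag i : eff_res o i i = 0.
Proof. by rewrite /eff_res /= subrr mulmx0 mxE. Qed.

(** Expanding [R i j] gives [P i i + P j j - P i j - P j i]; the first two
    terms are annihilated by the zero-sum condition. *)
Lemma quad_resmx (T : {set V}) (u : 'cV[K]_#|T|) : dot (ones #|T|) u = 0 ->
  quad (resmx o T) u = - 2 * quad (mpinv (laplacian o)) (embed u).
Proof.
rewrite dot_ones => su; set P := mpinv _.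
pose B (i j : 'I_#|T|) :=
  dot (stdvec (enum_val i)) (P *m stdvec (enum_val j)) : K.
have resE i j : resmx o T i j = B i i + B j j - B i j - B j i.
  rewrite mxE /eff_res -/P /= -mulmxA -/(dot _ _) mulmxBr dotDr dotNr !dotDl !dotNl.
  by rewrite /B; ring.
have -> : quad P (embed u) = \sum_i \sum_j u i ord0 * u j ord0 * B i j.
  rewrite quad_dot /embed mulmx_sumr dot_suml; apply: eq_bigr => i _.
  rewrite dot_sumr; apply: eq_bigr => j _.
  by rewrite -scalemxAr dotZr dotZl; rewrite /B; ring.
have row0 : \sum_i \sum_j u i ord0 * u j ord0 * B i i = 0.
  rewrite big1 // => i _; rewrite -mulr_suml -mulr_sumr su.
  by rewrite mulr0 mul0r.
have col0 : \sum_i \sum_j u i ord0 * u j ord0 * B j j = 0.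
  rewrite exchange_big big1 //= => j _; rewrite -!mulr_suml su.
  by rewrite !mul0r.
have swap : \sum_i \sum_j u i ord0 * u j ord0 * B j i
          = \sum_i \sum_j u i ord0 * u j ord0 * B i j.
  rewrite exchange_big; apply: eq_bigr => i _; apply: eq_bigr => j _.
  by rewrite (mulrC (u j ord0)).
transitivity (\sum_i \sum_j u i ord0 * u j ord0 * B i i
   + \sum_i \sum_j u i ord0 * u j ord0 * B j j
   - \sum_i \sum_j u i ord0 * u j ord0 * B i j
   - \sum_i \sum_j u i ord0 * u j ord0 * B j i); last first.
  by rewrite row0 col0 swap; ring.
rewrite quad_sum -big_split -!sumrB; apply: eq_bigr => i _ /=.
rewrite -big_split -!sumrB; apply: eq_bigr => j _ /=.
by rewrite resE; ring.
Qed.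

Lemma resmx_neg_type (T : {set V}) : strict_negative_type (resmx o T).
Proof.
split=> [|i|u su u0].
- by apply/matrixP => i j; rewrite !mxE eff_res_sym.
- by rewrite mxE eff_res_diag.
rewrite quad_resmx // mulNr oppr_lt0 pmulr_rgt0 // quad_mpinv_gt0 //.
  rewrite dot_sumr -[RHS]su dot_ones; apply: eq_bigr => i _.
  by rewrite dotZr dot_delta mxE mulr1.
apply: contraNneq u0 => eu0; apply/eqP/colP => i.
by rewrite -embed_in eu0 !mxE.
Qed.

(** * Bordering a set by one vertex *)

Section Border.
Variables (S : {set V}) (x : V).
Hypothesis xS : x \notin S.

(** The block vector [(u, t)], with [u] on [S] and [t] at [x]. The enumeration
    of [x |: S] need not place [x] first or last, so the coordinates are read
    off from a vector on all of [V]. *)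
Definition border (u : 'cV[K]_#|S|) (t : K) : 'cV[K]_#|x |: S| :=
  \col_i (embed u + t *: stdvec x) (enum_rank (enum_val i)) ord0.

Definition rescol : 'cV[K]_#|S| := \col_s eff_res o (enum_val s) x.

Let bvec (u : 'cV[K]_#|S|) t v : K := (embed u + t *: stdvec x) (enum_rank v) ord0.

Let bvec_x u t : bvec u t x = t.
Proof. by rewrite /bvec !mxE embed_out // !eqxx mulr1 add0r. Qed.

Let bvec_S u t i : bvec u t (enum_val i) = u i ord0.
Proof.
rewrite /bvec mxE embed_in !mxE (inj_eq enum_rank_inj).
have [ix|] := eqVneq (enum_val i) x; last by rewrite mulr0 addr0.
by move: xS; rewrite -ix enum_valP.
Qed.

Let sum_border (F : V -> K) :
  \sum_(i < #|x |: S|) F (enum_val i) = F x + \sum_(i < #|S|) F (enum_val i).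
Proof. by rewrite -!big_enum_val big_setU1. Qed.

Lemma border_x u t : border u t (enum_rank_in (setU11 x S) x) ord0 = t.
Proof. by rewrite mxE enum_rankK_in ?setU11 // -/(bvec u t x) bvec_x. Qed.

Lemma dot_border u t v s : dot (border u t) (border v s) = t * s + dot u v.
Proof.
have := sum_border (fun w => bvec u t w * bvec v s w).
rewrite /= !bvec_x !dotE => sumE.
transitivity (\sum_(i < #|x |: S|) bvec u t (enum_val i) * bvec v s (enum_val i)).
  by apply: eq_bigr => i _; rewrite [border u t _ _]mxE [border v s _ _]mxE.
rewrite sumE; congr (_ + _).
by apply: eq_bigr => i _; rewrite !bvec_S.
Qed.

Let eq_border (w : 'cV[K]_#|x |: S|) (F : V -> K) (u : 'cV[K]_#|S|) t :
  (forall i, w i ord0 = F (enum_val i)) ->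
  F x = t -> (forall i, F (enum_val i) = u i ord0) -> w = border u t.
Proof.
move=> wF Fx FS; apply/colP => i; rewrite wF mxE -/(bvec _ _ _).
have /setU1P[->|vS] := enum_valP i; first by rewrite Fx bvec_x.
by rewrite -[enum_val i](enum_rankK_in vS vS) FS bvec_S.
Qed.

Lemma ones_border : ones #|x |: S| = border (ones #|S|) 1.
Proof. by apply: (@eq_border _ (fun=> 1)) => // i; rewrite !mxE. Qed.

(** In the splitting of the coordinates into those of [S] and that of [x], the
    enlarged resistance matrix is the block matrix with blocks [resmx o S],
    [rescol], its transpose, and [0]. *)
Lemma resmx_border u t :
  resmx o (x |: S) *m border u t
  = border (resmx o S *m u + t *: rescol) (dot rescol u).
Proof.
pose F v := \sum_(j < #|x |: S|) eff_res o v (enum_val j) * bvec u t (enum_val j).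
have FE v : F v = eff_res o v x * t
     + \sum_(j < #|S|) eff_res o v (enum_val j) * u j ord0.
  rewrite /F (sum_border (fun w => eff_res o v w * bvec u t w)) bvec_x.
  by congr (_ + _); apply: eq_bigr => j _; rewrite bvec_S.
apply: (@eq_border _ F) => [i||i].
- rewrite mxE; apply: eq_bigr => j _.
  by rewrite [resmx _ _ _ _]mxE [border _ _ _ _]mxE.
- rewrite FE eff_res_diag mul0r add0r dotE.
  by apply: eq_bigr => j _; rewrite mxE eff_res_sym.
rewrite FE !mxE addrC mulrC; congr (_ + _).
by apply: eq_bigr => j _; rewrite mxE.
Qed.

End Border.

End Resistance.

Theorem theorem4p4 (K : realFieldType) (V E : finType) (G : wgraph K V E)
    (o : orientation G) (S : {set V}) (x : V)
    (Gconn : connected G) (S_ge2 : (2 <= #|S|)%N) (xS : x \notin S) :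
  let A : 'M[K]_#|S| := resmx o S in
  let b : 'cV[K]_#|S| := \col_s eff_res o (enum_val s) x in
  let a : K := (b^T *m invmx A *m ones #|S|) ord0 ord0 in
  let eta : K := (b^T *m invmx A *m b) ord0 ord0 in
  [/\ 0 < eta,
      1 / rho o (x |: S) = 1 / rho o S - (a - 1) ^+ 2 / eta,
      rho o (x |: S) = rho o S * eta / (eta - rho o S * (a - 1) ^+ 2) &
      exists u : 'cV[K]_#|x |: S|,
        unique (is_maximizer (resmx o (x |: S))) u /\
        u (enum_rank_in (setU11 x S) x) ord0
          = rho o (x |: S) * ((a - 1) / eta)].
Proof.
move=> A b a eta.
have Aneg : strict_negative_type A := resmx_neg_type o Gconn S.
have A'neg := resmx_neg_type o Gconn (x |: S); set A' := resmx o _ in A'neg.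
have A'_gt1 : (1 < #|x |: S|)%N by rewrite cardsU1 xS ltnW.
have symA : A^T = A := neg_type_sym Aneg.
have uA : A \in unitmx := neg_type_unitmx Aneg S_ge2.
pose y := invmx A *m ones #|S|; pose z := invmx A *m b.
have Ay : A *m y = ones #|S| by rewrite mulKVmx.
have Az : A *m z = b by rewrite mulKVmx.
have by_a : dot b y = a by rewrite /dot mulmxA.
have bz_eta : dot b z = eta by rewrite /dot mulmxA.
have z1_a : dot (ones #|S|) z = a.
  by rewrite -by_a -Az -[in RHS]symA -dot_mulmx Ay dotC.
have rhoS : rho o S = (dot (ones #|S|) y)^-1 by apply: det_div_sum_cofactors.
have rhoS' : rho o (x |: S) = (dot (ones _) (invmx A' *m ones _))^-1.
  by apply: det_div_sum_cofactors; apply: neg_type_unitmx.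
have sy_gt0 : 0 < dot (ones #|S|) y := neg_type_inv_ones_gt0 Aneg S_ge2.
have sy'_gt0 := neg_type_inv_ones_gt0 A'neg A'_gt1.
have eta_gt0 : 0 < eta.
  have m_gt0 : 0 < dot (ones #|S|) (ones #|S|) :> K := dot_ones_ones_gt0 S_ge2.
  (* [c] makes the sum of [(z, -1) - c (1, 0)] vanish. *)
  pose c := (a - 1) / dot (ones #|S|) (ones #|S|).
  pose w := border x (z - c *: ones #|S|) (- 1).
  have sw : dot (ones _) w = 0.
    rewrite ones_border // dot_border // dotDr dotNr dotZr z1_a /c.
    by field; apply: lt0r_neq0.
  have w0 : w != 0.
    apply/eqP => /(congr1 (fun u : 'cV__ => u (enum_rank_in (setU11 x S) x) ord0)).
    by move/eqP; rewrite border_x // mxE oppr_eq0 oner_eq0.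
  have [_ _ /(_ w sw w0)] := A'neg.
  (* There is no cross term: the image of [(z, -1)] under [A'] is [(0, eta)]. *)
  have -> : quad A' w = c ^+ 2 * quad A (ones #|S|) - eta.
    rewrite !quad_dot /w resmx_border // dot_border // -/A -[rescol o S x]/b.
    rewrite mulmxBr -scalemxAr Az scaleN1r addrAC subrr add0r.
    rewrite !(dotDl, dotDr, dotNl, dotNr, dotZl, dotZr) bz_eta.
    by rewrite (dot_mulmx A z) symA Az; ring.
  have := neg_type_quad_ones_gt0 Aneg S_ge2; have := sqr_ge0 c.
  move=> c2 q; have := mulr_ge0 c2 (ltW q); lra.
have eta0 := lt0r_neq0 eta_gt0.
(* The two block equations for [(p, q)] are [A p + q b = 1] and [b^T p = 1]:
   the first forces [p = y - q z], and then the second reads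
   [a - q eta = 1]. *)
pose q := (a - 1) / eta.
have y'E : invmx A' *m ones _ = border x (y - q *: z) q.
  have uA' : A' \in unitmx by apply: neg_type_unitmx.
  rewrite -[RHS](mulKmx uA') resmx_border // -/A -[rescol o S x]/b.
  rewrite mulmxBr -scalemxAr Ay Az subrK ones_border //.
  rewrite dotDr dotNr dotZr by_a bz_eta; congr (_ *m border _ _ _).
  by rewrite /q; field.
have sy' : dot (ones _) (invmx A' *m ones _)
    = dot (ones #|S|) y - (a - 1) ^+ 2 / eta.
  rewrite y'E ones_border // dot_border // dotDr dotNr dotZr z1_a /q.
  by field.
have sy0 := lt0r_neq0 sy_gt0; have sy'0 := lt0r_neq0 sy'_gt0.
split=> //.
- by rewrite rhoS rhoS' sy' !div1r !invrK.
- rewrite rhoS rhoS' sy'; rewrite sy' in sy'0.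
  have den0 : eta * dot (ones #|S|) y - (a - 1) ^+ 2 != 0.
    apply: contraNneq sy'0 => den0; apply/eqP.
    by rewrite -[RHS](mul0r eta^-1) -den0; field.
  have -> : eta - (dot (ones #|S|) y)^-1 * (a - 1) ^+ 2
       = (eta * dot (ones #|S|) y - (a - 1) ^+ 2) / dot (ones #|S|) y by field.
  have -> : dot (ones #|S|) y - (a - 1) ^+ 2 / eta
       = (eta * dot (ones #|S|) y - (a - 1) ^+ 2) / eta by field.
  by field; rewrite den0 sy0 eta0.
exists ((dot (ones _) (invmx A' *m ones _))^-1 *: (invmx A' *m ones _)); split.
  exact: neg_type_maximizer.
by rewrite mxE -rhoS' y'E border_x.
Qed.
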